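(* Let $(X,T)$ be a topological dynamical system. (1) $(X,T)$ is uniformly rigid if and only if there are a strictly increasing sequence $(r_k)_{k\ge 1}\subseteq\mathbb N$ and a countable point-separating family $\mathcal G\subseteq C(X)$ such that $$\|f\circ T^{r_k}-f\|_\infty\longrightarrow 0\quad (k\to\infty)\qquad\text{for every } f\in\mathcal G .$$ (2) For every strictly increasing sequence $\mathbf r=(r_k)_{k\ge1}\subseteq\mathbb N$, the set $$\mathcal A_{\mathbf r}(X,T)=\{f\in C(X):\ \|f\circ T^{r_k}-f\|_\infty\longrightarrow 0\}$$ is a closed unital $T^{\pm1}$-invariant subalgebra of $C(X)$. It determines the maximal factor of $(X,T)$ which is uniformly rigid along $\mathbf r$; that is, there is a factor map $\pi_{\mathbf r}:(X,T)\to(Y_{\mathbf r},S_{\mathbf r})$ with $\pi_{\mathbf r}^*C(Y_{\mathbf r})=\mathcal A_{\mathbf r}(X,T)$ such that $\mathbf r$ is a uniform rigidity sequence for $(Y_{\mathbf r},S_{\mathbf r})$, and every factor map $q:(X,T)\to(Z,R)$ for which $\mathbf r$ is a uniform rigidity sequence for $(Z,R)$ is of the form $q=\theta\circ\pi_{\mathbf r}$ for some factor map $\theta:(Y_{\mathbf r},S_{\mathbf r})\to(Z,R)$.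
   Context: $\mathbb N=\{1,2,\dots\}$. A topological dynamical system is a pair $(X,T)$ with $X$ a nonempty compact metric space (with a compatible metric $d$) and $T:X\to X$ a homeomorphism. $C(X)=C(X,\mathbb R)$ is the real algebra of continuous real-valued functions, $\|\cdot\|_\infty$ is the sup norm. All algebras are real subalgebras of $C(X)$; unital means containing the constant function $\mathbf 1$; closed means closed in sup norm; $\mathcal A$ is $T^{\pm1}$-invariant if $f\circ T^j\in\mathcal A$ for all $f\in\mathcal A$ and $j\in\mathbb Z$. A family $\mathcal G\subseteq C(X)$ is point-separating if for all distinct $x,y\in X$ some $f\in\mathcal G$ has $f(x)\ne f(y)$. A strictly increasing sequence $(r_k)\subseteq\mathbb N$ is a uniform rigidity sequence for $(X,T)$ if $\sup_{x\in X}d(T^{r_k}x,x)\to0$ (this does not depend on the compatible metric); one then also says $(X,T)$ is uniformly rigid along $(r_k)$. $(X,T)$ is uniformly rigid if it admits a uniform rigidity sequence. A factor map $\pi:(X,T)\to(Y,S)$ between topological dynamical systems is a continuous surjection with $\pi T=S\pi$; its target is a factor of $(X,T)$. The pullback algebra is $\pi^*C(Y)=\{h\circ\pi: h\in C(Y)\}$. *)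

(* Defs.v *)
From mathcomp Require Import all_boot all_order all_algebra.
From mathcomp Require Import all_classical all_reals all_analysis.

Set Implicit Arguments.
Unset Strict Implicit.
Unset Printing Implicit Defensive.

Import Order.TTheory GRing.Theory Num.Theory.
Import numFieldNormedType.Exports.

Local Open Scope classical_set_scope.
Local Open Scope ring_scope.

(* The inverse of the homeomorphism is carried as a field; it is determined by
   [tmap] through the two cancellation laws. [metricType] does not entail
   nonemptiness, hence the separate field. *)
Record tds (R : realType) : Type := Tds {
  space :> metricType R;
  space_nonempty : [set: space] !=set0;
  space_compact : compact [set: space];
  tmap : space -> space;
  tinv : space -> space;
  tmap_continuous : continuous tmap;
  tinv_continuous : continuous tinv;
  tmapK : cancel tmap tinv;
  tinvK : cancel tinv tmap
}.

Section Systems.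
Context {R : realType}.
Implicit Types X Y Z : tds R.

Definition tpow X (j : int) : X -> X :=
  match j with
  | Posz n => iter n (@tmap R X)
  | Negz n => iter n.+1 (@tinv R X)
  end.

Definition C_ X : set (X -> R) := [set f | continuous f].
Arguments C_ : clear implicits.

(* [sup] is the genuine supremum on bounded nonempty sets only, which is the
   case here since the space is compact, nonempty and [f] will be continuous. *)
Definition supnorm X (f : X -> R) : R := sup (range (fun x => `|f x|)).

Definition point_separating X (G : set (X -> R)) : Prop :=
  forall x y : X, x <> y -> exists2 f, G f & f x <> f y.

Definition subalgebra X (A : set (X -> R)) : Prop :=
  [/\ A `<=` C_ X,
      A (cst 0),
      forall f g, A f -> A g -> A (f \+ g),
      forall (a : R) f, A f -> A (a \*o f)
    & forall f g, A f -> A g -> A (f \* g)].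

Definition unital X (A : set (X -> R)) : Prop := A (cst 1).

Definition sup_closed X (A : set (X -> R)) : Prop :=
  forall f, C_ X f ->
    (forall e : R, 0 < e -> exists2 g, A g & supnorm (g \- f) < e) -> A f.

Definition T_invariant X (A : set (X -> R)) : Prop :=
  forall f (j : int), A f -> A (f \o @tpow X j).

(* Strictly increasing sequences of positive integers, indexed from 0. *)
Definition incr_seq (r : nat -> nat) : Prop :=
  (forall k, 0 < r k)%N /\ {homo r : m n / (m < n)%N}.

Definition rigidity_seq X (r : nat -> nat) : Prop :=
  incr_seq r /\
  sup (range (fun x : X => mdist (iter (r k) (@tmap R X) x) x))
    @[k --> \oo] --> (0 : R).

Definition uniformly_rigid X : Prop := exists r, rigidity_seq X r.

Definition asymp_fixed X (r : nat -> nat) (f : X -> R) : Prop :=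
  supnorm ((f \o iter (r k) (@tmap R X)) \- f) @[k --> \oo] --> (0 : R).

Definition rigid_algebra X (r : nat -> nat) : set (X -> R) :=
  [set f | C_ X f /\ asymp_fixed r f].
Arguments rigid_algebra : clear implicits.

Definition factor_map X Y (p : X -> Y) : Prop :=
  [/\ continuous p, range p = [set: Y]
    & p \o @tmap R X = @tmap R Y \o p].

Definition pullback X Y (p : X -> Y) : set (X -> R) :=
  [set h \o p | h in C_ Y].

End Systems.

Arguments C_ {R} X.
Arguments rigid_algebra {R} X r.

(* Main.v *)
Require Import Defs.
From HB Require Import structures.
From mathcomp Require Import all_boot all_order all_algebra.
From mathcomp Require Import all_classical all_reals all_analysis.
From mathcomp Require Import lra.

(** Uniform rigidity and asymptotically fixed functions are linked by one
    compactness argument on [X * X], [vanish_unif_separated]. If a family of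
    continuous functions separates points and each of its members [f] satisfies
    [f (T^(r_k) x) - f x -> 0] uniformly, then any neighbourhood of the diagonal
    contains all pairs [(T^(r_k) x, x)] for [k] large, so that the distance of
    these pairs tends to [0] uniformly ([separating_rigidity_seq]). Applied the
    other way round, with the distance as the only given function, the same
    lemma shows that along a rigidity sequence every continuous function is
    asymptotically fixed ([rigidity_asymp_fixed]).

    This gives the first part up to countability. A compact metric space is
    second countable, and therefore every nonempty family of continuous
    functions has a countable subfamily separating the same points
    ([countable_separating]); it is applied to all of [C(X)].

    For the second part, the algebra properties are estimates of the sup norm.
    The factor [Y] is the quotient of [X] by the relation of not being separated
    by the algebra [A]. To metrize it, take a sequence in [A] separating the
    same points as [A], and form the pseudo-distance [seqdist], the supremum of
    the [n]-th differences truncated at [1 / (n + 1)]. It is continuous and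
    vanishes exactly on the relation, so its metric quotient is [Y]
    ([metric_quotient], [algebra_factor]). Since [X] is compact, every
    continuous map on [X] constant on the fibres of [p : X -> Y] descends
    continuously ([factor_through]).

    In particular the members of [A] descend, and they separate the points of
    [Y]; so the sequence is a rigidity sequence for [Y] by the first argument.
    But then every continuous [h] on [Y] is asymptotically fixed, so [h \o p]
    belongs to [A], and the pullback is exactly [A]. Finally, if [q : X -> Z] is a factor
    map onto a system rigid along the same sequence, the functions [h \o q]
    belong to [A] and determine [q], so [q] is constant on the fibres of [p]
    and factors through it. *)

Set Implicit Arguments.
Unset Strict Implicit.
Unset Printing Implicit Defensive.

Import Order.TTheory GRing.Theory Num.Theory.
Import numFieldNormedType.Exports.

Local Open Scope classical_set_scope.
Local Open Scope ring_scope.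

(** * Uniform convergence to zero *)

Definition vanish_unif {R : realType} {W : Type} (u : nat -> W -> R) : Prop :=
  forall e : R, 0 < e -> \forall k \near \oo, forall w, `|u k w| <= e.

Lemma vanish_unifP {R : realType} {W : Type} (u : nat -> W -> R) :
  [set: W] !=set0 -> (forall k, has_ubound (range (fun w => `|u k w|))) ->
  sup (range (fun w => `|u k w|)) @[k --> \oo] --> (0 : R) <-> vanish_unif u.
Proof.
move=> [w0 _] ub; split=> [/cvgrPdist_le cu e e0|vu].
  near=> k => w.
  suff : `|0 - sup (range (fun w => `|u k w|))| <= e.
    rewrite sub0r normrN; apply: le_trans; apply: le_trans (ler_norm _).
    by apply: ub_le_sup => //; exists w.
  by near: k; exact: cu.
apply/cvgrPdist_le => e e0; near=> k; rewrite sub0r normrN ger0_norm.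
  apply: ge_sup; first by exists `|u k w0|, w0.
  by move=> _ [w _ <-]; move: w; near: k; exact: vu.
rewrite (le_trans (normr_ge0 (u k w0)))//.
by apply: ub_le_sup => //; exists w0.
Unshelve. all: by end_near. Qed.

Lemma compact_norm_ubound {R : realType} {K : topologicalType} (f : K -> R) :
  compact [set: K] -> continuous f -> has_ubound (range (fun x => `|f x|)).
Proof.
move=> cK cf.
have /compact_bounded : compact (range f).
  by apply: continuous_compact => //; exact: continuous_subspaceT.
move=> [M [_ /(_ (M + 1))]]; rewrite ltrDl ltr01 => /(_ isT) bM.
by exists (M + 1) => _ [x _ <-]; apply: bM; exists x.
Qed.

(** The compactness argument behind both passages between the metric and the
    continuous functions. Near a point where [u] vanishes, [u] is small by
    continuity; near any other point some [g] in [G] stays away from [0], and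
    since [g] tends to [0] along [phi], the points [phi k w] eventually avoid
    that neighbourhood. Finitely many such neighbourhoods cover [K].
    Below, [K] is the square of a space and [phi k x] is the pair
    [(T^(r_k) x, x)]. With [u] the distance and [G] the differences of the
    functions of a separating family it yields rigidity; with [u] the
    difference of a single function and [G] the distance alone it plays the
    role of uniform continuity. *)
Lemma vanish_unif_separated {R : realType} {K : topologicalType} {W : Type}
    (phi : nat -> W -> K) (u : K -> R) (G : set (K -> R)) :
  compact [set: K] -> continuous u ->
  (forall z, u z != 0 -> exists2 g, G g & g z != 0) ->
  (forall g, G g -> continuous g /\ vanish_unif (fun k => g \o phi k)) ->
  vanish_unif (fun k => u \o phi k).
Proof.
move=> /compact_near_coveringP cK cu sep vG e e0.
suff : \forall k \near \oo,
    [set: K] `<=` [set z | forall w, phi k w = z -> `|u z| <= e].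
  by apply: filterS => k kP w; exact: (kP (phi k w)).
apply: cK => z _; have [uz0|/sep[g Gg gz0]] := eqVneq (u z) 0.
  have : \forall z' \near z, `|u z - u z'| <= e by have /cvgrPdist_le := cu z; exact.
  rewrite uz0 => zP.
  exists ([set z' | `|0 - u z'| <= e], setT); first by split => //; exact: filterT.
  by move=> [z' k] /= [+ _] w _; rewrite sub0r normrN.
have [cg vg] := vG _ Gg.
have d0 : 0 < `|g z| / 2 by rewrite divr_gt0// normr_gt0.
exists ([set z' | `|g z - g z'| < `|g z| / 2],
        [set k | forall w, `|g (phi k w)| <= `|g z| / 2]).
  by split; [have /cvgrPdist_lt := cg z; exact|exact: vg].
move=> [z' k] /= [zz' kP] w phiz; move: (kP w); rewrite phiz => gz'.
suff : `|g z| < `|g z| by rewrite ltxx.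
rewrite -[X in `|X| < _](subrK (g z')) (le_lt_trans (ler_normD _ _))//.
by rewrite [ltRHS]splitr ltr_leD.
Qed.

(** The distance is 1-Lipschitz in each variable, which is [tri]. *)
Lemma mdist_continuous {R : realType} (X : metricType R) :
  continuous (fun z : X * X => mdist z.1 z.2).
Proof.
have tri (a b a' b' : X) : mdist a b - mdist a' b' <= mdist a a' + mdist b b'.
  rewrite lerBlDr (le_trans (metric_triangle _ a' _))// -addrA lerD2l.
  by rewrite (le_trans (metric_triangle _ b' _))// addrC (metric_sym b' b).
move=> [x y]; apply/cvgrPdist_le => e e0.
have e20 : 0 < e / 2 by rewrite divr_gt0.
exists (ball x (e / 2), ball y (e / 2)) => [|[x' y'] /=].
  by split; exact: nbhsx_ballx.
rewrite !ballEmdist/= => -[xx' yy'].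
have exy : mdist x x' + mdist y y' <= e by rewrite [leRHS]splitr lerD// ltW.
rewrite ler_norml lerNl opprB !(le_trans (tri _ _ _ _))//.
by rewrite (metric_sym x') (metric_sym y').
Qed.

(** * Countable subfamilies that separate as well as the whole family *)

Lemma compact_metric_second_countable {R : realType} (X : metricType R) :
  [set: X] !=set0 -> compact [set: X] -> @second_countable X.
Proof.
move=> [x0 _].
pose Xp : pseudoPMetricType R := HB.pack (Metric.sort X) (isPointed.Build X x0).
exact: (@compact_second_countable R Xp).
Qed.

(** A pair of points told apart by some [g] in [A] lies in a product of two
    basic open sets on which [g] already tells apart all pairs, so choosing one
    function of [A] for each such product of basic sets is enough. *)
Lemma countable_separating {R : realType} (X : topologicalType)
    (A : set (X -> R)) :
  @second_countable X -> A !=set0 -> A `<=` [set f | continuous f] ->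
  exists2 f : nat -> X -> R, range f `<=` A &
    forall x y, (forall n, f n x = f n y) -> forall g, A g -> g x = g y.
Proof.
move=> [B cB [_ basisB]] [f0 Af0] cA.
pose sep (UV : set X * set X) (f : X -> R) :=
  A f /\ forall x y, UV.1 x -> UV.2 y -> f x <> f y.
pose F UV := xget f0 (sep UV).
have AF UV : A (F UV) by rewrite /F; case: xgetP => // f -> [].
have /pfcard_geP[BB0|[e]] : countable (B `*` B) by exact: countableX.
  exists (fun=> f0) => [_ [_ _ <-]//|x y _ g _].
  have [U [BU _] _] := basisB x _ filterT.
  by have := (conj BU BU : (B `*` B) (U, U)); rewrite BB0.
exists (F \o e) => [_ [n _ <-]|x y fxy g Ag]; first exact: AF.
apply: contrapT => gxy.
have d0 : 0 < `|g x - g y| / 2.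
  by rewrite divr_gt0// normr_gt0 subr_eq0; exact/eqP.
have near_half z : \forall z' \near z, `|g z - g z'| < `|g x - g y| / 2.
  by have /cvgrPdist_lt := cA _ Ag z; exact.
have [U [BU Ux] gU] := basisB _ _ (near_half x).
have [V [BV Vy] gV] := basisB _ _ (near_half y).
have [_ sepF] : sep (U, V) (F (U, V)).
  apply: (@xgetPex _ f0 (sep (U, V))); exists g; split=> //= x' y'.
  move=> /gU/= gx' /gV/= gy' gxy'.
  suff : `|g x - g y| < `|g x - g y| by rewrite ltxx.
  rewrite [ltRHS]splitr (le_lt_trans (ler_distD (g x') _ _))// ltrD//.
  by rewrite gxy' distrC.
have [n _ en] := 'surj_e (conj BU BV : (B `*` B) (U, V)).
by apply: (sepF x y) => //; rewrite -en; exact: fxy.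
Qed.

(** * The metric quotient attached to a sequence of functions *)

Section seqdist.
Context {R : realType} {X : Type}.
Variable f : nat -> X -> R.

(** The truncation at [1 / (n + 1)] keeps the supremum finite whatever the
    functions are, and makes all but finitely many terms uniformly small, so
    that continuity of the [f n] passes to the supremum. *)
Definition seqdist (x y : X) : R :=
  sup (range (fun n => Num.min `|f n x - f n y| n.+1%:R^-1)).

Lemma seqdist_ge n x y : Num.min `|f n x - f n y| n.+1%:R^-1 <= seqdist x y.
Proof.
apply: ub_le_sup; last by exists n.
by exists 1 => _ [m _ <-]; rewrite ge_min invf_le1// ler1n orbT.
Qed.

Lemma seqdist_le x y e :
  (forall n, Num.min `|f n x - f n y| n.+1%:R^-1 <= e) -> seqdist x y <= e.
Proof.
by move=> le_e; apply: ge_sup => [|_ [n _ <-]//]; eexists; exists 0%N.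
Qed.

Lemma seqdist_ge0 x y : 0 <= seqdist x y.
Proof.
by apply: (le_trans _ (seqdist_ge 0%N x y)); rewrite le_min normr_ge0 invr_ge0 ler0n.
Qed.

Lemma seqdist_eq0 x y : seqdist x y = 0 <-> forall n, f n x = f n y.
Proof.
split=> [d0 n|fxy].
  have := seqdist_ge n x y; rewrite d0 ge_min normr_le0 subr_eq0.
  by rewrite [X in _ || X]leNgt invr_gt0 ltr0Sn orbF => /eqP.
apply/eqP; rewrite eq_le seqdist_ge0 andbT; apply: seqdist_le => n.
by rewrite fxy subrr normr0 ge_min lexx.
Qed.

Lemma seqdist_sym x y : seqdist x y = seqdist y x.
Proof.
by rewrite /seqdist; under eq_fun do rewrite distrC.
Qed.

(** Truncating at a nonnegative constant preserves the triangle inequality. *)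
Lemma seqdist_triangle y x z : seqdist x z <= seqdist x y + seqdist y z.
Proof.
apply: seqdist_le => n.
apply: le_trans (lerD (seqdist_ge n x y) (seqdist_ge n y z)).
have c0 : 0 <= n.+1%:R^-1 :> R by [].
have txz := ler_distD (f n y) (f n x) (f n z).
have [yx|yx] := leP `|f n x - f n y| n.+1%:R^-1.
  have [yz|yz] := leP `|f n y - f n z| n.+1%:R^-1; rewrite ge_min.
    by rewrite txz.
  by rewrite lerDr normr_ge0 orbT.
by rewrite ge_min lerDl le_min normr_ge0 c0 orbT.
Qed.

End seqdist.

Lemma seqdist_continuous {R : realType} {X : topologicalType}
    (f : nat -> X -> R) (x : X) (e : R) :
  (forall n, continuous (f n)) -> 0 < e ->
  \forall y \near x, seqdist f x y <= e.
Proof.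
move=> cf e0; have [N _ Ne] : \forall n \near \oo, n.+1%:R^-1 < e.
  exact: near_infty_natSinv_lt (PosNum e0).
have : \forall y \near x, forall n : 'I_N, `|f n x - f n y| <= e.
  by apply: filter_forall => n; have /cvgrPdist_le := cf n x; exact.
apply: filterS => y fy; apply: seqdist_le => n; rewrite ge_min.
have [nN|Nn] := ltnP n N; first by rewrite (fy (Ordinal nN)).
by rewrite orbC ltW ?Ne.
Qed.

(** Identifying the points at pseudo-distance [0] turns a pseudo-distance
    into a distance, evaluated here on canonical representatives of the
    classes. *)
Lemma metric_quotient {R : realType} (X : choiceType) (rho : X -> X -> R) :
  (forall x, rho x x = 0) -> (forall x y, rho x y = rho y x) ->
  (forall y x z, rho x z <= rho x y + rho y z) ->
  exists (Y : metricType R) (p : X -> Y),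
    range p = [set: Y] /\ forall x y, mdist (p x) (p y) = rho x y.
Proof.
move=> rho0 rhoC rhoD.
have rho_ge0 x y : 0 <= rho x y.
  by rewrite -(@pmulrn_lge0 _ _ 2)// -(rho0 x) mulr2n [X in _ + X]rhoC.
have refl : reflexive (fun x y => rho x y == 0) by move=> x; rewrite rho0.
have sym : symmetric (fun x y => rho x y == 0) by move=> x y; rewrite rhoC.
have trans : transitive (fun x y => rho x y == 0).
  move=> y x z /eqP xy /eqP yz; rewrite eq_le rho_ge0 andbT.
  by rewrite (le_trans (rhoD y _ _))// xy yz addr0.
pose E := EquivRel _ refl sym trans.
pose Q := {eq_quot E}%qT.
pose pi (x : X) : Q := (\pi_Q x)%qT.
pose dist (u v : Q) : R := rho (repr u) (repr v).
have reprE x : rho x (repr (pi x)) = 0.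
  by apply/eqP; rewrite -[_ == _]/(E x (repr (pi x))); apply/eqmodP; rewrite reprK.
have distE x y : dist (pi x) (pi y) = rho x y.
  apply/le_anti/andP; split.
    rewrite (le_trans (rhoD x _ _))// (rhoC _ x) reprE add0r.
    by rewrite (le_trans (rhoD y _ _))// reprE addr0.
  rewrite (le_trans (rhoD (repr (pi x)) _ _))// reprE add0r.
  by rewrite (le_trans (rhoD (repr (pi y)) _ _))// (rhoC _ y) reprE addr0.
have dist0 u : dist u u = 0 by exact: rho0.
have dist_pos u v : dist u v = 0 -> u = v.
  by move=> /eqP uv; rewrite -[u]reprK -[v]reprK; apply/eqmodP.
pose Y : metricType R := HB.pack Q
  (isMetric.Build R Q dist0 dist_pos (fun u v => rhoC _ _)
     (fun v u w => rhoD _ _ _)).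
exists Y, pi; split=> //; apply/seteqP; split=> // u _.
by exists (repr u) => //; rewrite /pi reprK.
Qed.

(** A continuous surjection [p] from a compact space onto a Hausdorff space is
    closed, hence a quotient map: the preimage of a closed set under the
    induced map is the image under [p] of a closed, hence compact, set. *)
Lemma factor_through {X Y Z : topologicalType} (p : X -> Y) (q : X -> Z) :
  compact [set: X] -> hausdorff_space Y -> continuous p -> continuous q ->
  range p = [set: Y] -> (forall x y, p x = p y -> q x = q y) ->
  exists2 t : Y -> Z, continuous t & q = t \o p.
Proof.
move=> cX hY cp cq pY pq.
have /choice[s ps] : forall y, exists x, p x = y.
  by move=> y; have [x _ <-] : range p y; [rewrite pY|exists x].
have qE : q = (q \o s) \o p by apply/funext => x; apply: pq; rewrite ps.
exists (q \o s) => //; apply/continuous_closedP => C cC.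
have -> : (q \o s) @^-1` C = p @` (q @^-1` C).
  apply/seteqP; split=> [y Cy|_ [x Cx <-]]; first by exists (s y).
  by rewrite /preimage/= -(pq x (s (p x))) ?ps.
apply: compact_closed => //; apply: continuous_compact.
  exact: continuous_subspaceT.
apply: subclosed_compact cX _ => //.
by move/continuous_closedP : cq; exact.
Qed.

(** * Functions asymptotically fixed along a sequence *)

Lemma vanish_unifD {R : realType} {W : Type} (u v : nat -> W -> R) :
  vanish_unif u -> vanish_unif v -> vanish_unif (fun k => u k \+ v k).
Proof.
move=> vu vv e e0; have e20 : 0 < e / 2 by rewrite divr_gt0.
near=> k => w; rewrite /= (le_trans (ler_normD _ _))// [leRHS]splitr lerD//.
- by move: w; near: k; exact: vu.
- by move: w; near: k; exact: vv.
Unshelve. all: by end_near. Qed.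

Lemma vanish_unifM {R : realType} {W : Type} (b : R) (v u : nat -> W -> R) :
  (forall k w, `|v k w| <= b) -> vanish_unif u ->
  vanish_unif (fun k => v k \* u k).
Proof.
move=> vb vu e e0.
have b0 : 0 < `|b| + 1 by rewrite ltr_wpDl.
near=> k => w; rewrite /= normrM.
have ue : `|u k w| <= e / (`|b| + 1).
  by move: w; near: k; apply: vu; rewrite divr_gt0.
apply: le_trans (ler_pM (normr_ge0 _) (normr_ge0 _) (vb k w) ue) _.
by rewrite mulrCA ger_pMr// ler_pdivrMr// mul1r (le_trans (ler_norm b))// lerDl.
Unshelve. all: by end_near. Qed.

Lemma iter_continuous {X : topologicalType} (f : X -> X) n :
  continuous f -> continuous (iter n f).
Proof.
move=> cf; elim: n => [|n IH] x; first exact: cvg_id.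
exact: (@continuous_comp _ _ _ (iter n f) f x (IH x) (cf _)).
Qed.

Section systems.
Context {R : realType}.
Implicit Types X Y Z : tds R.

Lemma asymp_fixedP X (r : nat -> nat) (f : X -> R) : C_ X f ->
  asymp_fixed r f <->
  vanish_unif (fun k x => f (iter (r k) (@tmap R X) x) - f x).
Proof.
move=> cf; apply: vanish_unifP; first exact: space_nonempty.
move=> k; apply: compact_norm_ubound; first exact: space_compact.
move=> x; apply: cvgB; last exact: cf.
apply: (@continuous_comp _ _ _ (iter (r k) (@tmap R X)) f); last exact: cf.
by apply: iter_continuous; exact: tmap_continuous.
Qed.

Lemma rigidityP X (r : nat -> nat) :
  sup (range (fun x : X => mdist (iter (r k) (@tmap R X) x) x))
    @[k --> \oo] --> (0 : R) <->
  vanish_unif (fun k (x : X) => mdist (iter (r k) (@tmap R X) x) x).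
Proof.
rewrite -vanish_unifP; last 2 first.
- exact: space_nonempty.
- move=> k; apply: compact_norm_ubound; first exact: space_compact.
  move=> x; apply: (@continuous_comp _ _ _
    (fun x : X => (iter (r k) (@tmap R X) x, x)) (fun z => mdist z.1 z.2)).
    apply: cvg_pair; last exact: cvg_id.
    by apply: iter_continuous; exact: tmap_continuous.
  exact: mdist_continuous.
suff -> : (fun k => sup (range (fun x : X =>
    `|mdist (iter (r k) (@tmap R X) x) x|))) =
  (fun k => sup (range (fun x : X => mdist (iter (r k) (@tmap R X) x) x))) by [].
by apply/funext => k; under eq_fun do rewrite ger0_norm ?mdist_ge0//.
Qed.

Lemma continuous_diff {X : topologicalType} (f : X -> R) :
  continuous f -> continuous (fun z : X * X => f z.1 - f z.2).
Proof.
move=> cf z; apply: cvgB.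
  exact: (@continuous_comp _ _ _ fst f _ (@cvg_fst _ _ _ _ _) (cf _)).
exact: (@continuous_comp _ _ _ snd f _ (@cvg_snd _ _ _ _ _) (cf _)).
Qed.

Lemma compact_square X : compact [set: X * X].
Proof. by rewrite -setXTT; apply: compact_setX; exact: space_compact. Qed.

(** A separating family of asymptotically fixed functions forces rigidity:
    the differences [f z.1 - f z.2] vanish together only on the diagonal. *)
Lemma separating_rigidity_seq X (r : nat -> nat) (G : set (X -> R)) :
  incr_seq r -> G `<=` C_ X -> point_separating G ->
  (forall f, G f -> asymp_fixed r f) -> rigidity_seq X r.
Proof.
move=> ir GC sepG fixG; split=> //; apply/rigidityP.
apply: (@vanish_unif_separated _ (X * X)%type _
  (fun k x => (iter (r k) (@tmap R X) x, x)) (fun z => mdist z.1 z.2)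
  [set (fun z : X * X => f z.1 - f z.2) | f in G]).
- exact: compact_square.
- exact: mdist_continuous.
- move=> [x y] /=; rewrite -normr_gt0 ger0_norm ?mdist_ge0// mdist_gt0.
  move=> /eqP/sepG[f Gf fxy].
  exists (fun z : X * X => f z.1 - f z.2); first by exists f.
  by rewrite subr_eq0; exact/eqP.
- move=> _ [f Gf <-]; split; first exact/continuous_diff/GC.
  by have /(asymp_fixedP _ (GC _ Gf)) := fixG _ Gf.
Qed.

(** Conversely the distance vanishes only on the diagonal, where every
    [f z.1 - f z.2] vanishes. *)
Lemma rigidity_asymp_fixed X (r : nat -> nat) (f : X -> R) :
  rigidity_seq X r -> C_ X f -> asymp_fixed r f.
Proof.
move=> [_ /rigidityP rX] cf; apply/asymp_fixedP => //.
apply: (@vanish_unif_separated _ (X * X)%type _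
  (fun k x => (iter (r k) (@tmap R X) x, x)) (fun z : X * X => f z.1 - f z.2)
  [set (fun z : X * X => mdist z.1 z.2)]).
- exact: compact_square.
- exact: continuous_diff.
- move=> [x y] /=; rewrite subr_eq0 => /eqP fxy.
  exists (fun z => mdist z.1 z.2) => //=.
  by apply/eqP => /mdist_positivity xy; apply: fxy; rewrite xy.
- by move=> _ ->; split => //; exact: mdist_continuous.
Qed.

(** Powers of [T] commute, which is why composing an asymptotically fixed
    function with a power of [T] only moves the point of evaluation. *)
Lemma iter_tpow X (j : int) n (x : X) :
  iter n (@tmap R X) (tpow j x) = tpow j (iter n (@tmap R X) x).
Proof.
case: j => m /=; first by rewrite -!iterD addnC.
have comm i y : iter i (@tinv R X) (@tmap R X y) =
    @tmap R X (iter i (@tinv R X) y).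
  by elim: i => // i /= ->; rewrite tmapK tinvK.
elim: n => // n IHn; rewrite [LHS]iterS IHn.
by rewrite -[@tinv R X (iter m _ _)]iterS -comm.
Qed.

Lemma tpow_continuous X (j : int) : continuous (@tpow R X j).
Proof.
by case: j => n; apply: iter_continuous;
  [exact: tmap_continuous|exact: tinv_continuous].
Qed.

(** * The algebra of asymptotically fixed functions *)

Section rigid_algebra.
Variables (X : tds R) (r : nat -> nat).

Lemma rigid_algebraP (f : X -> R) : rigid_algebra X r f <->
  C_ X f /\ vanish_unif (fun k x => f (iter (r k) (@tmap R X) x) - f x).
Proof. by split=> -[cf fix_f]; split=> //; apply/asymp_fixedP. Qed.

Lemma rigid_algebra_cst (a : R) : rigid_algebra X r (cst a).
Proof.
apply/rigid_algebraP; split=> [|e e0]; first exact: cst_continuous.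
by near=> k => x /=; rewrite subrr normr0 ltW.
Unshelve. all: by end_near. Qed.

Lemma rigid_algebraD f g : rigid_algebra X r f -> rigid_algebra X r g ->
  rigid_algebra X r (f \+ g).
Proof.
move=> /rigid_algebraP[cf vf] /rigid_algebraP[cg vg]; apply/rigid_algebraP.
split=> [x|]; first exact: cvgD (cf x) (cg x).
have := vanish_unifD vf vg; congr vanish_unif.
by apply/funext => k; apply/funext => x /=; rewrite opprD addrACA.
Qed.

(** With [T] standing for [T^(r_k)],
    [(f g) T - f g = (f T) (g T - g) + g (f T - f)], and [f T] and [g] are
    bounded by compactness. *)
Lemma rigid_algebraM f g : rigid_algebra X r f -> rigid_algebra X r g ->
  rigid_algebra X r (f \* g).
Proof.
move=> /rigid_algebraP[cf vf] /rigid_algebraP[cg vg]; apply/rigid_algebraP.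
split=> [x|]; first exact: cvgM (cf x) (cg x).
have [a fa] := compact_norm_ubound (@space_compact R X) cf.
have [b gb] := compact_norm_ubound (@space_compact R X) cg.
have fav k x : `|f (iter (r k) (@tmap R X) x)| <= a by apply: fa; eexists.
have gbv (k : nat) x : `|g x| <= b by apply: gb; exists x.
have := vanish_unifD (vanish_unifM fav vg) (vanish_unifM gbv vf).
congr vanish_unif; apply/funext => k; apply/funext => x /=.
by rewrite !mulrBr [g x * f x]mulrC [g x * _]mulrC addrA subrK.
Qed.

Lemma rigid_subalgebra : subalgebra (rigid_algebra X r).
Proof.
split=> [f []//||f g|a f Af|f g].
- exact: rigid_algebra_cst.
- exact: rigid_algebraD.
- exact: (rigid_algebraM (rigid_algebra_cst a) Af).
- exact: rigid_algebraM.
Qed.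

Lemma rigid_algebra_sup_closed : sup_closed (rigid_algebra X r).
Proof.
move=> f cf approx; apply/rigid_algebraP; split=> // e e0.
have e30 : 0 < e / 3 by rewrite divr_gt0.
have [g /rigid_algebraP[cg vg] gf] := approx _ e30.
have gfx x : `|g x - f x| <= e / 3.
  apply: le_trans (ltW gf); apply: ub_le_sup; last by exists x.
  apply: (@compact_norm_ubound _ _ (g \- f)); first exact: space_compact.
  by move=> y; exact: cvgB (cg y) (cf y).
near=> k => x.
have vgx : `|g (iter (r k) (@tmap R X) x) - g x| <= e / 3.
  by move: x; near: k; exact: vg.
set y := iter _ _ x in vgx *.
have -> : e = e / 3 + (e / 3 + e / 3) by lra.
rewrite (le_trans (ler_distD (g y) _ _))// lerD//; first by rewrite distrC.
by rewrite (le_trans (ler_distD (g x) _ _))// lerD.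
Unshelve. all: by end_near. Qed.

Lemma rigid_algebra_T_invariant : T_invariant (rigid_algebra X r).
Proof.
move=> f j /rigid_algebraP[cf vf]; apply/rigid_algebraP; split=> [x|e /vf].
  exact: (@continuous_comp _ _ _ (tpow j) f x (@tpow_continuous X j x) (cf _)).
by apply: filterS => k fk x /=; rewrite -iter_tpow; exact: fk.
Qed.

End rigid_algebra.

(** Asymptotic fixedness passes both ways through a factor map because the
    orbit map is intertwined and every point of the factor is attained. *)
Lemma rigid_algebra_factor X Y (r : nat -> nat) (p : X -> Y) (h : Y -> R) :
  factor_map p -> C_ Y h ->
  rigid_algebra X r (h \o p) <-> rigid_algebra Y r h.
Proof.
move=> [cp pY pT] ch.
have iterp n x : p (iter n (@tmap R X) x) = iter n (@tmap R Y) (p x).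
  by elim: n => // n /= <-; exact: (congr1 (@^~ _) pT).
split=> /rigid_algebraP[_ vh]; apply/rigid_algebraP; split=> //.
- move=> e /vh; apply: filterS => k hk y.
  by have [x _ <-] : range p y; [rewrite pY|rewrite -iterp; exact: hk].
- by move=> x; exact: (@continuous_comp _ _ _ p h x (cp x) (ch _)).
- by move=> e /vh; apply: filterS => k hk x; rewrite /= iterp; exact: hk.
Qed.

Lemma rigid_algebraT X (r : nat -> nat) :
  rigidity_seq X r -> rigid_algebra X r = C_ X.
Proof.
move=> rX; apply/seteqP; split=> f; first by case.
by move=> cf; split=> //; exact: rigidity_asymp_fixed.
Qed.

Lemma C_point_separating X : point_separating (C_ X).
Proof.
move=> x y xy; exists (mdist x) => [z|].
  apply: (@continuous_comp _ _ _ (fun z : X => (x, z))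
    (fun z => mdist z.1 z.2) z); last exact: mdist_continuous.
  by apply: cvg_pair; [exact: cvg_cst|exact: cvg_id].
by rewrite mdistxx => /esym/mdist_positivity.
Qed.

Lemma rigid_algebra_countable X (r : nat -> nat) :
  exists2 f : nat -> X -> R, range f `<=` rigid_algebra X r &
    forall x y, (forall n, f n x = f n y) ->
    forall g, rigid_algebra X r g -> g x = g y.
Proof.
apply: countable_separating.
- apply: compact_metric_second_countable;
    [exact: space_nonempty|exact: space_compact].
- by exists (cst 0); exact: rigid_algebra_cst.
- by move=> f [].
Qed.

(** * The factor determined by an invariant family *)

(** The factor is the metric quotient for [seqdist f], where [f] is a
    sequence in [A] that separates the same points as [A]. Invariance of [A] lets [T] and its
    inverse descend to the quotient. *)
Lemma algebra_factor X (A : set (X -> R)) (f : nat -> X -> R) :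
  A `<=` C_ X -> T_invariant A -> range f `<=` A ->
  (forall x y, (forall n, f n x = f n y) -> forall g, A g -> g x = g y) ->
  exists (Y : tds R) (p : X -> Y), factor_map p /\
    forall x y, p x = p y <-> forall g, A g -> g x = g y.
Proof.
move=> AC AT fA fsep.
have [Y [p [pY dp]]] := @metric_quotient R X (seqdist f)
  (fun x => (seqdist_eq0 f x x).2 (fun=> erefl)) (seqdist_sym f)
  (seqdist_triangle f).
have pP x y : p x = p y <-> forall g, A g -> g x = g y.
  have -> : (p x = p y) <-> seqdist f x y = 0.
    by rewrite -dp; split=> [->|/mdist_positivity//]; rewrite mdistxx.
  rewrite seqdist_eq0; split=> [|gxy n]; first exact: fsep.
  by apply: gxy; apply: fA; exists n.
have cp : continuous p.
  move=> x; apply/metricType_numDomainType.cvgrPdist_le => e e0.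
  have : \forall y \near x, seqdist f x y <= e.
    by apply: seqdist_continuous => // n; apply: AC; apply: fA; exists n.
  by apply: filterS => y; rewrite dp.
have pT (j : int) x y : p x = p y -> p (tpow j x) = p (tpow j y).
  by move=> /pP xy; apply/pP => g /(AT _ j)/xy.
have lift (j : int) : exists2 t : Y -> Y, continuous t & p \o tpow j = t \o p.
  apply: factor_through => //.
  - exact: space_compact.
  - exact: metric_hausdorff.
  - by move=> x; apply: (@continuous_comp _ _ _ (tpow j) p x);
      [exact: tpow_continuous|exact: cp].
  - exact: pT.
(* [tpow 1] and [tpow (-1)] are convertible to [T] and its inverse. *)
have [S cS pS] := lift 1; have [S' cS' pS'] := lift (-1).
have pSx x : S (p x) = p (@tmap R X x) by exact: (congr1 (@^~ x) (esym pS)).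
have pSx' x : S' (p x) = p (@tinv R X x) by exact: (congr1 (@^~ x) (esym pS')).
have pex y : exists x, p x = y.
  by have [x _ <-] : range p y; [rewrite pY|exists x].
have SK : cancel S S' by move=> y; have [x <-] := pex y; rewrite pSx pSx' tmapK.
have SK' : cancel S' S by move=> y; have [x <-] := pex y; rewrite pSx' pSx tinvK.
have Y0 : [set: Y] !=set0 by have [x _] := @space_nonempty R X; exists (p x).
have cY : compact [set: Y].
  rewrite -pY; apply: continuous_compact; last exact: space_compact.
  exact: continuous_subspaceT.
by exists (Tds Y0 cY cS cS' SK SK'), p; split.
Qed.

End systems.

(** * Characterization of uniform rigidity and the maximal rigid factor *)

Theorem theorem1 (R : realType) (X : tds R) :
  (uniformly_rigid X <->
     exists (r : nat -> nat) (G : set (X -> R)),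
       [/\ incr_seq r, countable G, G `<=` C_ X, point_separating G
         & forall f, G f -> asymp_fixed r f])
  /\
  (forall r : nat -> nat, incr_seq r ->
     [/\ subalgebra (rigid_algebra X r), unital (rigid_algebra X r),
         sup_closed (rigid_algebra X r) & T_invariant (rigid_algebra X r)]
     /\
     exists (Y : tds R) (p : X -> Y),
       [/\ factor_map p,
           pullback p = rigid_algebra X r,
           rigidity_seq Y r
         & forall (Z : tds R) (q : X -> Z),
             factor_map q -> rigidity_seq Z r ->
             exists2 t : Y -> Z, factor_map t & q = t \o p]).
Proof.
split.
  split=> [[r rX]|[r [G [ir _ GC sepG fixG]]]]; last first.
    by exists r; exact: separating_rigidity_seq fixG.
  (* Along a rigidity sequence the algebra is all of [C_ X], so its countable
     separating subfamily separates points. *)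
  have [f fA fsep] := rigid_algebra_countable X r.
  exists r, (range f); split.
  - by case: rX.
  - exact: card_image_le.
  - by move=> g /fA[].
  - move=> x y xy; apply: contrapT => nsep; have [g Cg gxy] := C_point_separating xy.
    apply: gxy; apply: (fsep x y); last by rewrite rigid_algebraT.
    by move=> n; apply: contrapT => fxy; apply: nsep; exists (f n) => //; exists n.
  - by move=> g /fA[].
move=> r ir; split.
  split.
  - exact: rigid_subalgebra.
  - exact: rigid_algebra_cst.
  - exact: rigid_algebra_sup_closed.
  - exact: rigid_algebra_T_invariant.
have [f fA fsep] := rigid_algebra_countable X r.
have [|Y [p [pfac pP]]] := algebra_factor _ (@rigid_algebra_T_invariant R X r) fA fsep.
  by move=> g [].
have [cp pY pT] := pfac.
have descend (Z : topologicalType) (q : X -> Z) : continuous q ->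
    (forall x y, p x = p y -> q x = q y) ->
    exists2 t : Y -> Z, continuous t & q = t \o p.
  by move=> cq pq; apply: factor_through => //;
    [exact: space_compact|exact: metric_hausdorff].
(* Functions of the algebra are constant on the fibres of [p]; the function they
   induce on [Y] is again asymptotically fixed. *)
have lift g : rigid_algebra X r g -> exists2 h, rigid_algebra Y r h & g = h \o p.
  move=> Ag; have [h ch gE] : exists2 h : Y -> R, continuous h & g = h \o p.
    apply: descend; first by case: Ag.
    by move=> x y /pP; exact.
  by exists h => //; apply/(rigid_algebra_factor _ pfac ch); rewrite -gE.
have rY : rigidity_seq Y r.
  apply: (@separating_rigidity_seq _ _ _ (rigid_algebra Y r)) => //.
  - by move=> h [].
  - move=> u v uv; apply: contrapT => nsep; apply: uv.
    have [x _ xu] : range p u by rewrite pY.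
    have [y _ yv] : range p v by rewrite pY.
    rewrite -xu -yv; apply/pP => g /lift[h Ah ->] /=.
    by rewrite xu yv; apply: contrapT => huv; apply: nsep; exists h.
  - by move=> h [].
exists Y, p; split => //.
  (* That [h \o p] is in the algebra comes from the rigidity of [Y], along which
     every continuous function is asymptotically fixed. *)
  apply/seteqP; split=> [_ [h ch <-]|g /lift[h [ch _] ->]]; last by exists h.
  by apply/(rigid_algebra_factor _ pfac ch); rewrite rigid_algebraT.
move=> Z q qfac rZ; have [cq qZ qT] := qfac.
have [t ct qE] : exists2 t : Y -> Z, continuous t & q = t \o p.
  (* Functions pulled back from [Z] lie in the algebra, and they separate the
     points of [Z]; hence [q] is constant on the fibres of [p]. *)
  apply: descend => // x y /pP pxy; apply: contrapT => /C_point_separating[h Ch].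
  apply; apply: (pxy (h \o q)).
  by apply/(rigid_algebra_factor _ qfac Ch); rewrite rigid_algebraT.
exists t => //; split => //.
  apply/seteqP; split=> // z _; have [x _ <-] : range q z by rewrite qZ.
  by exists (p x) => //; rewrite qE.
apply/funext => y; have [x _ <-] : range p y by rewrite pY.
have /= pTx := congr1 (@^~ x) pT; have /= qTx := congr1 (@^~ x) qT.
by rewrite /= -pTx; move: qTx; rewrite qE.
Qed.
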